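(* Let $d,k$ be positive integers. There exists $N=N(d,k)$ such that for every integer $n\ge N$, the value of the multiple-treasures-per-door search game with parameters $(n,d,k)$ is $$v_M(n,d,k)=\frac{k^d}{\binom{n+d-1}d}.$$
   Context: The multiple-treasures-per-door search game with parameters $(n,d,k)$ is the following two-player zero-sum game. First the hider places $d$ treasures behind $n$ doors; several treasures may be placed behind the same door. Then the searcher plays rounds: in each round she selects (guesses) a set of at most $k$ doors. If none of the selected doors hides a treasure not yet found, she loses immediately. Otherwise the hider reveals one not-yet-found treasure behind one of the selected doors (the hider chooses which one if there are several). The searcher wins if she finds all $d$ treasures with a total of $d$ guesses (rounds). The searcher's choices may be randomized and may depend on all previous answers; the hider may randomize. The value $v_M(n,d,k)$ is the probability that the searcher wins when both players play optimally. *)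

(* Defs.v *)
From mathcomp Require Import all_boot all_order all_algebra.
Set Implicit Arguments. Unset Strict Implicit. Unset Printing Implicit Defensive.
Import Order.TTheory GRing.Theory Num.Theory.
Local Open Scope ring_scope.

(* A pure searcher strategy: given the sequence of doors revealed so far
   (the answers), choose the next set of doors to guess. *)
Definition sstrat (n : nat) := seq 'I_n -> {set 'I_n}.

Definition sstrat_ok (n k : nat) (s : sstrat n) : Prop :=
  forall hist, (#|s hist| <= k)%N.

(* A pure hider strategy: a placement of d treasures behind the n doors
   (a d-tuple of doors; only the multiset of doors matters), and a
   revealing rule choosing, given the full history (guesses and answers)
   and the current guess, which door to reveal a treasure behind. *)
Record hstrat (n d : nat) := HStrat {
  placement : d.-tuple 'I_n;
  reveal : seq ({set 'I_n} * 'I_n) -> {set 'I_n} -> 'I_n }.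

(* One play: [r] rounds remain, [rem x] = number of not-yet-found treasures
   behind door x.  If the hider's chosen door is not a legal answer (not
   selected, or no unfound treasure there), a canonical legal door is
   used instead, so the hider can only make legal answers. *)
Fixpoint play (n : nat) (s : sstrat n)
    (rv : seq ({set 'I_n} * 'I_n) -> {set 'I_n} -> 'I_n)
    (r : nat) (rem : 'I_n -> nat) (ahist : seq 'I_n)
    (hhist : seq ({set 'I_n} * 'I_n)) : bool :=
  match r with
  | 0 => true
  | r'.+1 =>
      let G := s ahist in
      let legal := [set x in G | (0 < rem x)%N] in
      if legal == set0 then false
      else
        let c := rv hhist G in
        let a := if c \in legal then c else odflt c [pick x in legal] in
        play s rv r' (fun x => if x == a then (rem x).-1 else rem x)
             (rcons ahist a) (rcons hhist (G, a))
  end.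

Definition wins (n d : nat) (s : sstrat n) (h : hstrat n d) : bool :=
  play s (reveal h) d (fun x => count_mem x (placement h)) [::] [::].

Fixpoint allP (T : Type) (P : T -> Prop) (m : seq T) : Prop :=
  if m is x :: m' then P x /\ allP P m' else True.

(* Mixed strategies: finitely supported probability distributions over
   pure strategies, given as lists of (weight, strategy). *)
Definition distrib (R : realFieldType) (T : Type) (m : seq (R * T)) : Prop :=
  allP (fun p => 0 <= p.1) m /\ \sum_(p <- m) p.1 = 1.

Definition payoffS (R : realFieldType) (n d : nat)
    (sigma : seq (R * sstrat n)) (h : hstrat n d) : R :=
  \sum_(p <- sigma) p.1 * (wins p.2 h)%:R.

Definition payoffH (R : realFieldType) (n d : nat)
    (tau : seq (R * hstrat n d)) (s : sstrat n) : R :=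
  \sum_(p <- tau) p.1 * (wins s p.2)%:R.

Definition is_value_M (R : realFieldType) (n d k : nat) (v : R) : Prop :=
  (exists sigma : seq (R * sstrat n),
      distrib sigma /\ allP (fun p => sstrat_ok k p.2) sigma /\
      forall h : hstrat n d, v <= payoffS sigma h) /\
  (exists tau : seq (R * hstrat n d),
      distrib tau /\
      forall s : sstrat n, sstrat_ok k s -> payoffH tau s <= v).

(* Main.v *)
(* Upper bound: against a pure searcher strategy the answers of a winning play
   form one of at most k^d sequences, and that sequence determines the multiset
   of treasures; so a uniformly random multiset is lost by the hider with
   probability at most k^d / C(n+d-1, d), whatever the revealing rule.

   Lower bound: the searcher never guesses again a door that was guessed but not
   revealed, except that she may keep the last revealed door.  She thus wins only
   if every guess contains exactly one door with unfound treasures, and then the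
   hider has no choice.  In each round after the first she guesses either the
   last revealed door c and k-1 untouched doors, or k untouched doors, taken
   uniformly at random.  When r treasures remain and j distinct doors have been
   found, c is included with probability k(r+j)/(n+r), at most 1 if n >= kd.  If
   the remaining treasures are all behind c or behind q of the f untouched doors,
   she then wins with probability
     k^r C(n, j+q) / (C(n+r, r+j) C(f, q)),
   which does not depend on how the treasures are spread over these doors. *)
From Pilot Require Import Defs.
From mathcomp Require Import all_boot all_order all_algebra.
From mathcomp Require Import ring zify.
(* [allP] must denote the one of Defs, not the reflection view of seq. *)
Import Pilot.Defs.
Import Order.TTheory GRing.Theory Num.Theory.
Set Implicit Arguments. Unset Strict Implicit. Unset Printing Implicit Defensive.
Local Open Scope ring_scope.

(** * Lists satisfying [allP], and binomial identities *)

Lemma allP_cat (T : Type) (P : T -> Prop) (s t : seq T) :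
  allP P s -> allP P t -> allP P (s ++ t).
Proof. by elim: s => //= x s IHs [Px Ps] Pt; split=> //; apply: IHs. Qed.

Lemma allP_map (S T : Type) (P : T -> Prop) (f : S -> T) (s : seq S) :
  allP (fun x => P (f x)) s -> allP P [seq f x | x <- s].
Proof. by elim: s => //= x s IHs [Px Ps]; split=> //; apply: IHs. Qed.

Lemma sub_allP (T : Type) (P Q : T -> Prop) (s : seq T) :
  (forall x, P x -> Q x) -> allP P s -> allP Q s.
Proof. by move=> PQ; elim: s => //= x s IHs [Px Ps]; split; [exact: PQ|exact: IHs]. Qed.

Lemma allP_allpairs (S : eqType) (T U : Type) (P : U -> Prop) (f : S -> T -> U)
    (s : seq S) (t : S -> seq T) :
  (forall x, x \in s -> allP (fun y => P (f x y)) (t x)) ->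
  allP P [seq f x y | x <- s, y <- t x].
Proof.
elim: s => //= x s IHs Pst; apply: allP_cat.
  by apply: allP_map; apply: Pst; rewrite mem_head.
by apply: IHs => y ys; apply: Pst; rewrite inE ys orbT.
Qed.

Lemma allP_allpairs_nondep (S T U : Type) (P : U -> Prop) (f : S -> T -> U)
    (s : seq S) (t : seq T) :
  allP (fun x => allP (fun y => P (f x y)) t) s ->
  allP P [seq f x y | x <- s, y <- t].
Proof.
by elim: s => //= x s IHs [Px Ps]; apply: allP_cat; [exact: allP_map|exact: IHs].
Qed.

Lemma sumr_ge0_allP (R : realFieldType) (T : Type) (P : T -> Prop) (F : T -> R)
    (s : seq T) :
  allP P s -> (forall x, P x -> 0 <= F x) -> 0 <= \sum_(x <- s) F x.
Proof.
move=> Ps F0; elim: s Ps => [|x s IHs] /=; first by rewrite big_nil.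
by move=> [Px Ps]; rewrite big_cons addr_ge0 ?F0 ?IHs.
Qed.

(** Both sides count ordered pairs of disjoint subsets of sizes [q] and [t] of a set of size [f];
    they vanish when [q + t > f]. *)
Lemma mul_bin_swap (f q t : nat) :
  ('C(f, q) * 'C(f - q, t) = 'C(f, t) * 'C(f - t, q))%N.
Proof.
have [le_qtf | lt_fqt] := leqP (q + t) f; last first.
  have [le_qf|lt_fq] := leqP q f; last first.
    by rewrite (bin_small lt_fq) (@bin_small (f - t)) ?muln0 //; lia.
  rewrite (@bin_small (f - q)) ?muln0; last by lia.
  have [le_tf|lt_ft] := leqP t f; last by rewrite (bin_small lt_ft).
  by rewrite (@bin_small (f - t)) ?muln0 //; lia.
have e1 := @bin_fact f q ltac:(lia).
have e2 := @bin_fact (f - q) t ltac:(lia).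
have e3 := @bin_fact f t ltac:(lia).
have e4 := @bin_fact (f - t) q ltac:(lia).
have e5 : (f - t - q = f - q - t)%N by lia.
rewrite e5 in e4.
have g0 : (0 < q`! * t`! * (f - q - t)`!)%N by rewrite !muln_gt0 !fact_gt0.
apply/eqP; rewrite -(eqn_pmul2r g0); apply/eqP.
transitivity f`!.
  by rewrite -e1 -e2; ring.
by rewrite -e3 -e4; ring.
Qed.

(** Both sides count the pairs of subsets of sizes [q.+1] and [t.+1] that meet in exactly one
    point. *)
Lemma mul_bin_swap_diag (f q t : nat) :
  (q.+1 * 'C(f - q.+1, t) * 'C(f, q.+1) = t.+1 * ('C(f, t.+1) * 'C(f - t.+1, q)))%N.
Proof.
case: f => [|f]; first by rewrite !bin0n !muln0.
rewrite !subSS mulnAC [RHS]mulnA -!mul_bin_diag /= -!mulnA.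
by rewrite mul_bin_swap.
Qed.

Lemma natr_bin_neq0 (R : realFieldType) (a b : nat) :
  (b <= a)%N -> ('C(a, b))%:R != 0 :> R.
Proof. by move=> ba; rewrite pnatr_eq0 -lt0n bin_gt0. Qed.

(** * Mixed strategies: mixtures, independent products and random guesses *)

Definition mixed_ok (R : realFieldType) (n k : nat) (sigma : seq (R * sstrat n)) : Prop :=
  distrib sigma /\ allP (fun p => sstrat_ok k p.2) sigma.

(** The strategies in [sigma] are continuations that start from an empty list of answers, while [rv]
    sees the true past [hh]. *)
Definition win_prob (R : realFieldType) (n : nat) (sigma : seq (R * sstrat n))
    (rv : seq ({set 'I_n} * 'I_n) -> {set 'I_n} -> 'I_n)
    (r : nat) (rem : 'I_n -> nat) (hh : seq ({set 'I_n} * 'I_n)) : R :=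
  \sum_(p <- sigma) p.1 * (play p.2 rv r rem [::] hh)%:R.

Lemma win_prob_ge0 (R : realFieldType) (n : nat) (sigma : seq (R * sstrat n)) rv r rem hh :
  distrib sigma -> 0 <= win_prob sigma rv r rem hh.
Proof. by move=> [s0 _]; apply: sumr_ge0_allP s0 _ => p p0; rewrite mulr_ge0. Qed.

Definition scale (R : realFieldType) (T : Type) (c : R) (m : seq (R * T)) :=
  [seq (c * p.1, p.2) | p <- m].

Lemma sum_scale (R : realFieldType) (T : Type) (c : R) (m : seq (R * T)) (F : T -> R) :
  \sum_(p <- scale c m) p.1 * F p.2 = c * \sum_(p <- m) p.1 * F p.2.
Proof. by rewrite big_map big_distrr /=; apply: eq_bigr => p _; rewrite mulrA. Qed.

Lemma mixed_ok_mix (R : realFieldType) (n k : nat) (c : R) (s t : seq (R * sstrat n)) :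
  0 <= c <= 1 -> mixed_ok k s -> mixed_ok k t ->
  mixed_ok k (scale c s ++ scale (1 - c) t).
Proof.
move=> /andP[c0 c1] [[s0 s1] sk] [[t0 t1] tk]; split; last first.
  by apply: allP_cat; apply: allP_map.
split.
  apply: allP_cat; apply: allP_map.
    by apply: sub_allP s0 => p p0; rewrite mulr_ge0.
  by apply: sub_allP t0 => p p0; rewrite mulr_ge0 // subr_ge0.
by rewrite big_cat !big_map -!big_distrr /= s1 t1 !mulr1 addrCA subrr addr0.
Qed.

Lemma win_prob_mix (R : realFieldType) (n : nat) (c : R) (s t : seq (R * sstrat n)) rv r rem hh :
  win_prob (scale c s ++ scale (1 - c) t) rv r rem hh =
  c * win_prob s rv r rem hh + (1 - c) * win_prob t rv r rem hh.
Proof.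
rewrite /win_prob big_cat /=.
by rewrite !(sum_scale _ _ (fun s0 => (play s0 rv r rem [::] hh)%:R)).
Qed.

(** A random function whose values at the points of [L] are drawn independently, with default [f0]
    outside [L]. It turns fresh randomness after each answer into one distribution over pure
    strategies. *)
Fixpoint product (R : realFieldType) (T : eqType) (S : Type) (f0 : T -> S)
    (sigma : T -> seq (R * S)) (L : seq T) : seq (R * (T -> S)) :=
  if L is a :: L' then
    [seq (p.1 * q.1, fun x => if x == a then p.2 else q.2 x)
      | p <- sigma a, q <- product f0 sigma L']
  else [:: (1, f0)].

Lemma distrib_product (R : realFieldType) (T : eqType) (S : Type) (f0 : T -> S)
    (sigma : T -> seq (R * S)) (L : seq T) :
  (forall a, distrib (sigma a)) -> distrib (product f0 sigma L).
Proof.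
move=> ds; elim: L => [|a L [IH0 IH1]] /=.
  by split; [split=> //=; exact: ler01|rewrite big_seq1].
have [s0 s1] := ds a; split.
  apply: allP_allpairs_nondep; apply: sub_allP s0 => p p0.
  by apply: sub_allP IH0 => q q0; rewrite mulr_ge0.
rewrite big_allpairs_dep /= -s1; apply: eq_bigr => p _.
by rewrite -big_distrr /= IH1 mulr1.
Qed.

Lemma allP_product (R : realFieldType) (T : eqType) (S : Type) (f0 : T -> S)
    (sigma : T -> seq (R * S)) (L : seq T) (P : S -> Prop) :
  (forall a, P (f0 a)) -> (forall a, allP (fun p => P p.2) (sigma a)) ->
  allP (fun q => forall a, P (q.2 a)) (product f0 sigma L).
Proof.
move=> P0 Ps; elim: L => [|a L IHL] //=.
apply: allP_allpairs_nondep; apply: sub_allP (Ps a) => p Pp.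
by apply: sub_allP IHL => q Pq x /=; case: ifP.
Qed.

Lemma sum_product (R : realFieldType) (T : eqType) (S : Type) (f0 : T -> S)
    (sigma : T -> seq (R * S)) (L : seq T) (F : S -> R) (a : T) :
  (forall a, distrib (sigma a)) -> a \in L ->
  \sum_(q <- product f0 sigma L) q.1 * F (q.2 a) = \sum_(p <- sigma a) p.1 * F p.2.
Proof.
move=> ds; elim: L => //= b L IHL; rewrite inE big_allpairs_dep /=.
have [-> _|_ /= aL] := eqVneq a b.
  have [_ L1] := distrib_product f0 L ds.
  by apply: eq_bigr => p _; rewrite -big_distrl -big_distrr /= L1 mulr1.
have [_ s1] := ds b.
under eq_bigr => p _.
  under eq_bigr => q _ do rewrite -mulrA.
  rewrite -big_distrr /= IHL //; over.
by rewrite -big_distrl /= s1 mul1r.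
Qed.

Definition branch (n : nat) (G : {set 'I_n}) (f : 'I_n -> sstrat n) : sstrat n :=
  fun hist => if hist is a :: hist' then f a hist' else G.

(* Guess [g B] for a uniformly random [B] in [A]; after the answer [a], continue
   with the mixed strategy [cont B a], drawn independently for each [a]. *)
Definition guess (R : realFieldType) (n : nat) (A : {set {set 'I_n}})
    (g : {set 'I_n} -> {set 'I_n}) (cont : {set 'I_n} -> 'I_n -> seq (R * sstrat n)) :=
  [seq (#|A|%:R^-1 * q.1, branch (g B) q.2)
    | B <- enum A, q <- product (fun _ _ => set0) (cont B) (enum 'I_n)].

Lemma mixed_ok_guess (R : realFieldType) (n k : nat) (A : {set {set 'I_n}})
    (g : {set 'I_n} -> {set 'I_n})
    (cont : {set 'I_n} -> 'I_n -> seq (R * sstrat n)) :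
  (0 < #|A|)%N -> (forall B, B \in A -> (#|g B| <= k)%N) ->
  (forall B a, B \in A -> mixed_ok k (cont B a)) ->
  mixed_ok k (guess A g cont).
Proof.
move=> A0 gk ck; split; last first.
  apply: allP_allpairs => B; rewrite mem_enum => BA.
  apply: (@sub_allP _ (fun q : R * ('I_n -> sstrat n) =>
    forall a, sstrat_ok k (q.2 a))).
    by move=> q qk [|a h] /=; [exact: gk|exact: qk].
  apply: (@allP_product _ _ _ _ _ _ (sstrat_ok k)).
    by move=> a h; rewrite cards0.
  by move=> a; have [] := ck B a BA.
have dP B : B \in A ->
    distrib (product (fun _ _ => set0) (cont B) (enum 'I_n)).
  by move=> BA; apply: distrib_product => a; have [] := ck B a BA.
split.
  apply: allP_allpairs => B; rewrite mem_enum => BA; have [B0 _] := dP B BA.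
  by apply: sub_allP B0 => q q0; rewrite mulr_ge0 // invr_ge0.
rewrite big_allpairs_dep /= big_enum /=.
under eq_bigr => B BA do rewrite -big_distrr /= (proj2 (dP B BA)) mulr1.
by rewrite sumr_const -[_ *+ #|A|]mulr_natl divff // pnatr_eq0 -lt0n.
Qed.

(** * Single rounds of play *)

Lemma play_cons (n : nat) (s : sstrat n) rv r rem a ah hh :
  play s rv r rem (a :: ah) hh = play (fun h => s (a :: h)) rv r rem ah hh.
Proof.
elim: r rem ah hh => //= r IHr rem ah hh.
by case: ifP => // _; rewrite IHr.
Qed.

Definition found (n : nat) (rem : 'I_n -> nat) (a : 'I_n) : 'I_n -> nat :=
  fun x => if x == a then (rem x).-1 else rem x.

(** With one legal door, both the hider's legal choice and the canonical default equal it, so [rv]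
    cannot influence this round. *)
Lemma play_forced (n : nat) (s : sstrat n) rv r rem hh x :
  [set y in s [::] | (0 < rem y)%N] = [set x] ->
  play s rv r.+1 rem [::] hh =
  play (fun h => s (x :: h)) rv r (found rem x) [::] (rcons hh (s [::], x)).
Proof.
move=> sx /=; rewrite sx; case: eqP => [/setP/(_ x)|_]; first by rewrite !inE eqxx.
rewrite play_cons; set a := if _ then _ else _.
suff -> : a = x by [].
rewrite /a inE; case: eqP => // _; case: pickP => /= [y|/(_ x)].
  by rewrite inE => /eqP.
by rewrite inE eqxx.
Qed.

Lemma sum_found (n : nat) (rem : 'I_n -> nat) (a : 'I_n) (r : nat) :
  (0 < rem a)%N -> (\sum_x rem x)%N = r.+1 -> (\sum_x found rem a x)%N = r.
Proof.
move=> a0; rewrite (bigD1 a) //= => sr; rewrite (bigD1 a) //= /found eqxx.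
have -> : (\sum_(x | x != a) (if x == a then (rem x).-1 else rem x)
    = \sum_(x | x != a) rem x)%N by apply: eq_bigr => x /negPf->.
by rewrite -[r]/(r.+1.-1) -sr -!subn1 addnC [in RHS]addnC addnBA.
Qed.

(** * Upper bound: a uniformly random multiset of treasures *)

Fixpoint leaves (n : nat) (s : sstrat n) (r : nat) (ah : seq 'I_n) : seq (seq 'I_n) :=
  if r is r'.+1 then
    [seq a :: l | a <- enum (s ah), l <- leaves s r' (rcons ah a)]
  else [:: [::]].

(** In [leaves] every door of a guess counts as a possible answer, whatever the placement, so each
    round multiplies the number of sequences by at most [k]. *)
Lemma size_leaves (n k : nat) (s : sstrat n) (r : nat) (ah : seq 'I_n) :
  sstrat_ok k s -> (size (leaves s r ah) <= k ^ r)%N.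
Proof.
move=> sk; elim: r ah => //= r IHr ah.
rewrite size_allpairs_dep sumnE big_map big_enum /=.
apply: (@leq_trans (\sum_(a in s ah) k ^ r)%N); first exact: leq_sum.
by rewrite sum_nat_const expnS leq_mul2r sk orbT.
Qed.

(** A won play reveals one treasure per round; with as many rounds as treasures, its answers list
    all of [rem]. *)
Lemma play_leaf (n : nat) (s : sstrat n) rv r rem ah hh :
  play s rv r rem ah hh -> (\sum_x rem x)%N = r ->
  exists2 l, l \in leaves s r ah & forall x, count_mem x l = rem x.
Proof.
elim: r rem ah hh => [|r IHr] rem ah hh /=.
  move=> _ /eqP; rewrite sum_nat_eq0 => /forallP rem0; exists [::] => // x.
  by have /eqP := rem0 x.
set L := [set x in s ah | _]; case: eqP => // /eqP L0.
set a := if _ then _ else _.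
have aL : a \in L.
  rewrite /a; case: ifP => // _; case: pickP => //= x0.
  by have /set0Pn[x xL] := L0; have := x0 x; rewrite xL.
have [aG a0] : a \in s ah /\ (0 < rem a)%N by move: aL; rewrite inE => /andP.
move=> pl sr; have [l ll lE] := IHr _ _ _ pl (sum_found a0 sr).
exists (a :: l).
  by apply: allpairs_f_dep; rewrite ?mem_enum.
by move=> x; rewrite /= lE /found; have [->|//] := eqVneq x a; rewrite add1n prednK.
Qed.

Lemma sum_count_mem (T : finType) (l : seq T) : (\sum_x count_mem x l)%N = size l.
Proof.
elim: l => [|a l IHl] /=; first by rewrite big1.
rewrite big_split /= IHl (bigD1 a) //= eqxx big1 ?addn0 ?add1n // => x.
by rewrite eq_sym => /negPf->.
Qed.

(** Sorted tuples represent multisets. By [play_leaf] each winning tuple is the sorted form of some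
    leaf. *)
Lemma card_wins (n d k : nat) (s : sstrat n.+1) rv :
  sstrat_ok k s ->
  (#|[set t : d.-tuple 'I_n.+1 | sorted leq (map val t) & wins s (HStrat t rv)]|
     <= k ^ d)%N.
Proof.
move=> sk; apply: leq_trans (size_leaves d [::] sk).
pose le (x y : 'I_n.+1) := (x <= y)%N.
rewrite -(size_map (sort le)) cardE -(size_map val).
apply: uniq_leq_size; first by rewrite (map_inj_uniq val_inj) enum_uniq.
move=> _ /mapP[t + ->]; rewrite mem_enum inE => /andP[st /play_leaf].
case=> [|l ll lE]; first by rewrite sum_count_mem size_tuple.
apply/mapP; exists l => //.
apply: (@sorted_eq _ le).
- by move=> x y z; apply: leq_trans.
- by move=> x y xy; apply/val_inj/anti_leq.
- by move: st; rewrite sorted_map.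
- by apply: sort_sorted => x y; apply: leq_total.
by rewrite perm_sym perm_sort; apply/seq.allP => x _; rewrite /= lE.
Qed.

Lemma hider_bound (R : realFieldType) (n d k : nat) :
  exists tau : seq (R * hstrat n.+1 d), distrib tau /\
    forall s, sstrat_ok k s -> payoffH tau s <= (k ^ d)%:R / ('C(d + n, d))%:R.
Proof.
pose T := [set t : d.-tuple 'I_n.+1 | sorted leq (map val t)].
pose rv (_ : seq ({set 'I_n.+1} * 'I_n.+1)) (_ : {set 'I_n.+1}) : 'I_n.+1 := ord0.
have cT : #|T| = 'C(d + n, d) by apply: card_sorted_tuples.
exists [seq (('C(d + n, d))%:R^-1, HStrat t rv) | t <- enum T]; split.
  split; last first.
    rewrite big_map big_enum /= sumr_const cT -[_ *+ _]mulr_natl divff //.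
    by rewrite pnatr_eq0 -lt0n bin_gt0 leq_addr.
  by apply: allP_map; elim: (enum T) => //= t l IHl; split=> //; rewrite invr_ge0 ler0n.
move=> s sk; rewrite /payoffH big_map big_enum /= -big_distrr /= mulrC.
apply: ler_wpM2r; first by rewrite invr_ge0.
rewrite -natr_sum ler_nat; apply: leq_trans (card_wins d rv sk).
rewrite -sum1_card big_mkcond [leqRHS]big_mkcond /=.
by apply: leq_sum => t _; rewrite !inE; do 2!case: ifP => //=.
Qed.

(** * Winning probability after one random guess *)

Local Arguments play : simpl never.

(** Draws outside [H] contribute at least 0. For [B] in [H] the answer is forced, and [sum_product]
    reduces the product to the single factor [cont B x]. *)
Lemma win_prob_guess (R : realFieldType) (n k : nat) (A H : {set {set 'I_n}})
    (g : {set 'I_n} -> {set 'I_n})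
    (cont : {set 'I_n} -> 'I_n -> seq (R * sstrat n)) rv r rem hh (v : R) :
  (forall B a, B \in A -> mixed_ok k (cont B a)) -> H \subset A ->
  (forall B, B \in H -> exists2 x, [set y in g B | (0 < rem y)%N] = [set x] &
     v <= win_prob (cont B x) rv r (found rem x) (rcons hh (g B, x))) ->
  #|H|%:R / #|A|%:R * v <= win_prob (guess A g cont) rv r.+1 rem hh.
Proof.
move=> ck HA Hv; rewrite /win_prob big_allpairs_dep big_enum /=.
rewrite (big_setID H) /= (setIidPr HA) -[X in X <= _]addr0; apply: lerD; last first.
  apply: sumr_ge0 => B; rewrite inE => /andP[_ BA].
  have [B0 _] := distrib_product (fun _ _ => set0) (enum 'I_n)
    (fun a => (proj1 (ck B a BA))).
  by apply: sumr_ge0_allP B0 _ => q q0; rewrite !mulr_ge0 // invr_ge0.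
rewrite -mulrA -sumr_const big_distrl /=; apply: ler_sum => B BH.
have BA := subsetP HA _ BH; have [x gx vx] := Hv B BH.
under eq_bigr => q _ do rewrite -mulrA (play_forced _ _ _ gx).
rewrite -big_distrr /= mul1r; apply: ler_wpM2l; first by rewrite invr_ge0.
rewrite (@sum_product _ _ _ _ _ _ (fun s : sstrat n =>
   (play s rv r (found rem x) [::] (rcons hh (g B, x)))%:R)) ?mem_enum //.
by move=> a; have [] := ck B a BA.
Qed.

Definition draws (n : nat) (F : {set 'I_n}) (t : nat) : {set {set 'I_n}} :=
  [set B : {set 'I_n} | B \subset F & #|B| == t].

(** Disjointness makes [x] the only element of [x |: D] in [Q], so the pair can be recovered from
    the union. *)
Lemma card_hits (n : nat) (Q E : {set 'I_n}) (t : nat) : [disjoint Q & E] ->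
  #|[set x |: D | x in Q, D in draws E t]| = (#|Q| * 'C(#|E|, t))%N.
Proof.
move=> QE; rewrite curry_imset2X card_in_imset ?cardsX ?cards_draws //.
move=> [x D] [y D']; rewrite !inE /= => /and3P[xQ DE _] /and3P[yQ DE' _] eqD.
have notE z : z \in Q -> z \notin E by move=> zQ; rewrite (disjointFr QE zQ).
have notD z : z \in Q -> (z \in D = false) * (z \in D' = false).
  by move=> /notE zE; split; apply: contraNF zE; apply: subsetP.
have xy : x = y.
  move/setP/(_ x): eqD; rewrite !inE eqxx !(notD x xQ) !orbF.
  by move/esym/eqP.
rewrite xy in eqD *; congr (_, _); apply/setP => z.
move/setP/(_ z): eqD; rewrite !inE; case: eqVneq => //= -> _.
by rewrite !(notD y yQ).
Qed.

(** By [mul_bin_swap_diag], a uniform [B] meets [Q] in exactly one door with probability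
    [t * 'C(#|F| - t, q) / 'C(#|F|, q.+1)], and the denominator under [u] cancels. This serves
    guesses both with and without the last revealed door. *)
Lemma win_prob_fresh (R : realFieldType) (n k : nat) (F Q : {set 'I_n}) (q t : nat)
    (g : {set 'I_n} -> {set 'I_n})
    (cont : {set 'I_n} -> 'I_n -> seq (R * sstrat n)) rv r rem hh (u : R) :
  (forall B a, B \in draws F t -> mixed_ok k (cont B a)) ->
  Q = [set x in F | (0 < rem x)%N] -> #|Q| = q.+1 -> (q + t <= #|F|)%N ->
  mixed_ok k (guess (draws F t) g cont) ->
  (forall B x, B \in draws F t -> B :&: Q = [set x] ->
     [set y in g B | (0 < rem y)%N] = [set x] /\
     u / ('C(#|F| - t, q))%:R
       <= win_prob (cont B x) rv r (found rem x) (rcons hh (g B, x))) ->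
  t%:R / ('C(#|F|, q.+1))%:R * u <= win_prob (guess (draws F t) g cont) rv r.+1 rem hh.
Proof.
move=> ck defQ cQ qt okg Hv; case: t qt ck okg Hv => [|t] qt ck okg Hv.
  (* The case [t = 0] arises when a guess of size one repeats the last door; the claimed bound is
     then 0. *)
  by rewrite !mul0r; apply: win_prob_ge0; case: okg.
have QF : Q \subset F by rewrite defQ; apply/subsetP => x; rewrite inE => /andP[].
pose H := [set x |: D | x in Q, D in draws (F :\: Q) t].
have QE : [disjoint Q & F :\: Q].
  by rewrite -setI_eq0; apply/eqP/setP => x; rewrite !inE; case: (x \in Q).
have cH : #|H| = (q.+1 * 'C(#|F| - q.+1, t))%N.
  by rewrite card_hits // cardsD (setIidPr QF) cQ.
have HP B : B \in H -> B \in draws F t.+1 /\ exists x, B :&: Q = [set x].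
  case/imset2P => x D xQ; rewrite inE => /andP[/subsetP DE /eqP cD] ->.
  have DQ y : y \in D -> (y \in Q) = false.
    by move=> /DE; rewrite inE => /andP[/negPf].
  split; last first.
    exists x; apply/setP => y; rewrite !inE; have [->|_] /= := eqVneq y x; first by rewrite xQ.
    by apply/negP => /andP[/DQ->].
  rewrite inE subUset sub1set (subsetP QF) //= cardsU1 cD; apply/andP; split.
    by apply/subsetP => y /DE; rewrite inE => /andP[].
  by case: (boolP (x \in D)) => // /DQ; rewrite xQ.
have HA : H \subset draws F t.+1 by apply/subsetP => B /HP[].
apply: le_trans
  (@win_prob_guess R n k _ _ g cont rv r rem hh (u / ('C(#|F| - t.+1, q))%:R) ck HA _);
  last by move=> B /HP[BA [x Bx]]; exists x; have [] := Hv B x BA Bx.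
rewrite cH cards_draws le_eqVlt; apply/orP; left; apply/eqP.
have z1 := @natr_bin_neq0 R #|F| q.+1 ltac:(lia).
have z2 := @natr_bin_neq0 R #|F| t.+1 ltac:(lia).
have z3 := @natr_bin_neq0 R (#|F| - t.+1)%N q ltac:(lia).
have /(congr1 (fun m => m%:R : R)) := mul_bin_swap_diag #|F| q t.
rewrite (natrM _ _ 'C(#|F|, q.+1)) (natrM _ t.+1) (natrM _ 'C(_, _)) => /(canRL (mulfK z1)) ->.
by field; rewrite z1 z2 z3.
Qed.

(** * The searcher's strategy and its winning probability *)

Lemma card_drawsD (n : nat) (F B : {set 'I_n}) (t : nat) :
  B \in draws F t -> #|F :\: B| = (#|F| - t)%N.
Proof. by rewrite inE => /andP[/setIidPr BF /eqP cB]; rewrite cardsD BF cB. Qed.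

(* Guesses have size [k.+1].  There are [r] rounds left, [j] distinct doors have
   been found, [c] is the last one, and [F] is the set of untouched doors.  Among
   all multisets listed door by door, in a random order of their doors, the
   uniform one repeats [c] next with probability [(r + j) / (n + r)]. *)
Fixpoint searcher (R : realFieldType) (n k r j : nat) (c : 'I_n) (F : {set 'I_n}) :
    seq (R * sstrat n) :=
  if r is r'.+1 then
    let p := (k.+1 * (r + j))%:R / (n + r)%:R in
    scale p (guess (draws F k) (fun B => c |: B)
      (fun B a => if a == c then searcher R k r' j c (F :\: B)
                  else searcher R k r' j.+1 a (F :\: B)))
    ++ scale (1 - p) (guess (draws F k.+1) id
      (fun B a => searcher R k r' j.+1 a (F :\: B)))
  else [:: (1, fun _ => set0)].

(** The first bound leaves enough untouched doors for all remaining draws; the second keeps the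
    probability of repeating [c] at most 1. *)
Lemma mixed_ok_searcher (R : realFieldType) (n k r j : nat) (c : 'I_n) (F : {set 'I_n}) :
  (k.+1 * r <= #|F|)%N -> (k.+1 * (r + j) <= n)%N ->
  mixed_ok k.+1 (searcher R k r j c F).
Proof.
elim: r j c F => [|r IHr] j c F.
  move=> _ _; split; last by split=> // h; rewrite cards0.
  by split; [split=> //=; exact: ler01|rewrite big_seq1].
rewrite mulnS => rF rn; apply: mixed_ok_mix.
- rewrite divr_ge0 //= ler_pdivrMr ?ltr0n ?addnS // mul1r ler_nat -addnS.
  by apply: leq_trans rn (leq_addr _ _).
- apply: mixed_ok_guess; first by rewrite cards_draws bin_gt0; lia.
    by move=> B; rewrite inE cardsU1 => /andP[_ /eqP->]; case: (c \notin B).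
  move=> B a BA; case: ifP => _; apply: IHr; rewrite ?(card_drawsD BA); lia.
apply: mixed_ok_guess; first by rewrite cards_draws bin_gt0; lia.
  by move=> B; rewrite inE => /andP[_ /eqP->].
move=> B a BA; apply: IHr; rewrite ?(card_drawsD BA); lia.
Qed.

Lemma card_support (n : nat) (rem : 'I_n -> nat) :
  (#|[set x | (0 < rem x)%N]| <= \sum_x rem x)%N.
Proof.
rewrite -sum1_card big_mkcond; apply: leq_sum => x _.
by rewrite inE; case: ifP.
Qed.

(* [q] is the number of doors of [F], with [#|F| = f], that hide treasures. *)
Definition state_value (R : realFieldType) (n k r j q f : nat) : R :=
  (k.+1 ^ r * 'C(n, j + q))%:R / ('C(n + r, r + j))%:R / ('C(f, q))%:R.

(** The recursion when [c] still hides a treasure: the guess must repeat [c], and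
    ['C(f - q, k) / 'C(f, k)] is the probability that its fresh doors miss all [q] treasure
    doors. *)
Lemma state_value_old (R : realFieldType) (n k r j q f : nat) :
  (q + k <= f)%N -> (r + j <= n)%N ->
  state_value R n k r.+1 j q f =
  (k.+1 * (r.+1 + j))%:R / (n + r.+1)%:R *
    (('C(f - q, k))%:R / ('C(f, k))%:R * state_value R n k r j q (f - k)).
Proof.
move=> qkf jn; rewrite /state_value.
have z1 := @natr_bin_neq0 R f q ltac:(lia).
have z2 := @natr_bin_neq0 R f k ltac:(lia).
have z3 := @natr_bin_neq0 R (f - k)%N q ltac:(lia).
have z4 := @natr_bin_neq0 R (n + r)%N (r + j)%N ltac:(lia).
have z5 := @natr_bin_neq0 R (n + r.+1)%N (r.+1 + j)%N ltac:(lia).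
have z6 : (n + r.+1)%:R != 0 :> R by rewrite pnatr_eq0 addnS.
have /(congr1 (fun m => m%:R : R)) := mul_bin_swap f q k.
rewrite !natrM mulrC => /(canRL (mulfK z1)) ->.
have := mul_bin_diag (n + r.+1) (r + j); rewrite -addSn addnS /= -addnS.
move=> /(congr1 (fun m => m%:R : R)); rewrite !natrM => /esym/(canRL (mulfK z5)) ->.
rewrite expnS natrM; move: z6; move eqx: (n + r.+1)%:R => x z6; rewrite ?eqx.
by field; rewrite z1 z2 z3 z4 z5 z6.
Qed.

(** The recursion when [c] is exhausted and one fresh door must hit. It rests on [p * k + (1 - p) *
    k.+1 = k.+1 - p = k.+1 * (n - j) / (n + r.+1)], which is [k.+1] times the ratio of the two large
    binomials. *)
Lemma state_value_new (R : realFieldType) (n k r j q f : nat) (p u : R) :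
  (q.+1 <= f)%N -> (r.+1 + j <= n)%N ->
  p = (k.+1 * (r.+1 + j))%:R / (n + r.+1)%:R ->
  u = (k.+1 ^ r * 'C(n, j.+1 + q))%:R / ('C(n + r, r + j.+1))%:R ->
  state_value R n k r.+1 j q.+1 f =
  p * (k%:R / ('C(f, q.+1))%:R * u) + (1 - p) * (k.+1%:R / ('C(f, q.+1))%:R * u).
Proof.
move=> qf jn -> ->; rewrite /state_value.
have z1 := @natr_bin_neq0 R f q.+1 ltac:(lia).
have z4 := @natr_bin_neq0 R (n + r)%N (r + j.+1)%N ltac:(lia).
have z5 := @natr_bin_neq0 R (n + r.+1)%N (r.+1 + j)%N ltac:(lia).
have z6 : (n + r.+1)%:R != 0 :> R by rewrite pnatr_eq0 addnS.
have z7 : (n - j)%:R != 0 :> R by rewrite pnatr_eq0; lia.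
have := mul_bin_down (n + r.+1) (r.+1 + j).
have -> : (n + r.+1 - (r.+1 + j) = n - j)%N by lia.
have -> : (n + r.+1).-1 = (n + r)%N by lia.
move=> /(congr1 (fun m => m%:R : R)); rewrite !natrM => E.
have -> : ('C(n + r.+1, r.+1 + j))%:R =
    (n + r.+1)%:R * ('C(n + r, r.+1 + j))%:R / (n - j)%:R :> R.
  by rewrite E mulrC mulKf.
rewrite -!(addSnnS r j) (addSnnS j q) in z4 *.
have sE : (r.+1 + j)%:R = (n + r.+1)%:R - (n - j)%:R :> R.
  by rewrite -natrB; [congr _%:R|]; lia.
rewrite sE expnS natrM; move: z6; move eqx: (n + r.+1)%:R => x z6; rewrite ?eqx.
by field; rewrite z1 z4 z6 z7.
Qed.

(** Restores the invariants of the induction: [x] becomes the last found door, and the rest of [B]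
    hides nothing because [B] meets [Q] only in [x]. *)
Lemma fresh_state (n t q : nat) (F B Q : {set 'I_n}) (rem : 'I_n -> nat) (x : 'I_n) :
  B \in draws F t -> Q = [set y in F | (0 < rem y)%N] -> #|Q| = q.+1 ->
  B :&: Q = [set x] -> (forall y, y \notin F -> rem y = 0%N) ->
  [/\ x \notin F :\: B,
      forall y, y \notin F :\: B -> y != x -> found rem x y = 0%N,
      #|[set y in F :\: B | (0 < found rem x y)%N]| = q & (0 < rem x)%N].
Proof.
move=> BA defQ cQ BQ remF.
have : x \in B :&: Q by rewrite BQ set11.
rewrite inE => /andP[xB xQ].
have x0 : (0 < rem x)%N by move: xQ; rewrite defQ inE => /andP[].
have xF : x \in F by move: xQ; rewrite defQ inE => /andP[].
split=> //.
- by rewrite inE xB.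
- move=> y yFB yx; rewrite /found (negPf yx).
  case: (boolP (y \in F)) => [yF|/remF//].
  have yB : y \in B by move: yFB; rewrite inE yF andbT negbK.
  move/setP/(_ y): BQ; rewrite !inE yB (negPf yx) defQ inE yF /=.
  by case: (rem y).
have -> : [set y in F :\: B | (0 < found rem x y)%N] = Q :\ x.
  apply/setP => y; rewrite !inE /found.
  have [->|yx] /= := eqVneq y x; first by rewrite xB.
  rewrite defQ inE; move/setP/(_ y): BQ; rewrite !inE (negPf yx) defQ inE.
  by case: (y \in B) => //=; case: (y \in F).
by apply/eqP; rewrite -eqSS -cQ (cardsD1 x Q) xQ.
Qed.

Lemma win_prob_searcher (R : realFieldType) (n k r j : nat) (c : 'I_n) (F : {set 'I_n})
    rem rv hh :
  c \notin F -> (k.+1 * r <= #|F|)%N -> (k.+1 * (r + j) <= n)%N ->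
  (forall x, x \notin F -> x != c -> rem x = 0%N) -> (\sum_x rem x)%N = r ->
  state_value R n k r j #|[set x in F | (0 < rem x)%N]| #|F|
    <= win_prob (searcher R k r j c F) rv r rem hh.
Proof.
elim: r j c F rem hh => [|r IHr] j c F rem hh cF rF rn remF sr.
  rewrite /win_prob big_seq1 mul1r /state_value /=.
  have -> : [set x in F | (0 < rem x)%N] = set0.
    apply/setP => x; rewrite !inE; apply/negP => /andP[_ x0].
    by have := card_support rem; rewrite sr leqn0 cards_eq0 => /eqP/setP/(_ x); rewrite !inE x0.
  rewrite cards0 bin0 divr1 expn0 mul1n !addn0 add0n divff //.
  by rewrite pnatr_eq0 -lt0n bin_gt0; lia.
set Q := [set x in F | (0 < rem x)%N].
have QS : Q \subset [set x | (0 < rem x)%N].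
  by apply/subsetP => x; rewrite !inE => /andP[].
have cS := card_support rem; rewrite sr in cS.
have cQr := leq_trans (subset_leq_card QS) cS.
rewrite mulnS in rF.
have rn' : (k.+1 * (r + j.+1) <= n)%N by lia.
have okc B a : B \in draws F k ->
    mixed_ok k.+1 (if a == c then searcher R k r j c (F :\: B)
                   else searcher R k r j.+1 a (F :\: B)).
  by move=> BA; case: ifP => _; apply: mixed_ok_searcher; rewrite ?(card_drawsD BA); lia.
have okn B a : B \in draws F k.+1 -> mixed_ok k.+1 (searcher R k r j.+1 a (F :\: B)).
  by move=> BA; apply: mixed_ok_searcher; rewrite ?(card_drawsD BA); lia.
have ok1 : mixed_ok k.+1 (guess (draws F k) (fun B => c |: B)
      (fun B a => if a == c then searcher R k r j c (F :\: B)
                  else searcher R k r j.+1 a (F :\: B))).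
  apply: mixed_ok_guess okc; first by rewrite cards_draws bin_gt0; lia.
  by move=> B; rewrite inE cardsU1 => /andP[_ /eqP->]; case: (c \notin B).
have ok2 : mixed_ok k.+1 (guess (draws F k.+1) id
      (fun B a => searcher R k r j.+1 a (F :\: B))).
  apply: mixed_ok_guess okn; first by rewrite cards_draws bin_gt0; lia.
  by move=> B; rewrite inE => /andP[_ /eqP->].
rewrite [searcher _ _ _ _ _ _]/= win_prob_mix.
set p := _ / _.
have p0 : 0 <= p by rewrite divr_ge0.
have p1 : 0 <= 1 - p.
  rewrite subr_ge0 ler_pdivrMr ?ltr0n ?addnS // mul1r ler_nat; lia.
have [c0|cpos] := posnP (rem c); last first.
  have cQr' : (#|Q| <= r)%N.
    rewrite -ltnS; apply: leq_trans cS.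
    have -> : #|Q|.+1 = #|c |: Q| by rewrite cardsU1 inE (negPf cF).
    apply: subset_leq_card; rewrite subUset QS andbT sub1set inE; exact: cpos.
  rewrite (@state_value_old R n k r j); [|lia|lia].
  (* The branch that does not repeat [c] is bounded below by 0. *)
  rewrite -[X in X <= _]addr0; apply: lerD; last first.
    by rewrite mulr_ge0 // win_prob_ge0 //; case: ok2.
  apply: ler_wpM2l => //.
  have QF : Q \subset F by apply/subsetP => x; rewrite inE => /andP[].
  (* The useful draws avoid [Q], which leaves [c] as the only legal answer. *)
  have HA : draws (F :\: Q) k \subset draws F k.
    apply/subsetP => B; rewrite !inE => /andP[BF ->]; rewrite andbT.
    exact: subset_trans BF (subsetDl _ _).
  apply: le_trans (win_prob_guess (v := state_value R n k r j #|Q| (#|F| - k)) okc HA _);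
    last first.
    move=> B BH; exists c.
      apply/setP => y; rewrite !inE; have [->|yc] /= := eqVneq y c; first by rewrite cpos.
      apply/negP => /andP[yB y0]; move: BH; rewrite inE => /andP[/subsetP/(_ y yB)].
      by rewrite !inE y0 andbT andNb.
    have BA := subsetP HA _ BH; rewrite eqxx.
    have BQ y : y \in B -> (y \in F) && (rem y == 0%N).
      move=> yB; move: BH; rewrite inE => /andP[/subsetP/(_ y yB)].
      by rewrite !inE => /andP[+ yF]; rewrite yF /= -eqn0Ngt => ->.
    have QE : [set y in F :\: B | (0 < found rem c y)%N] = Q.
      apply/setP => y; rewrite !inE /found.
      have [->|yc] := eqVneq y c; first by rewrite (negPf cF) andbF.
      by case: (boolP (y \in B)) => //= /BQ/andP[-> /eqP->].
    rewrite -{1}QE -(card_drawsD BA); apply: IHr.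
    - by rewrite inE (negPf cF) andbF.
    - by rewrite (card_drawsD BA); lia.
    - by lia.
    - move=> y; rewrite inE negb_and negbK /found => yFB yc; rewrite (negPf yc).
      by case/orP: yFB => [/BQ/andP[_ /eqP]|/remF/(_ yc)].
    exact: sum_found.
  by rewrite !cards_draws cardsD (setIidPr QF).
(* Now [c] is empty, so all remaining treasures lie in [F] and [Q] is nonempty. *)
have remF' y : y \notin F -> rem y = 0%N.
  by move=> yF; have [->|/remF->] := eqVneq y c.
have [q cQ] : exists q, #|Q| = q.+1.
  exists #|Q|.-1; rewrite prednK // card_gt0; apply/set0Pn.
  have [x x0] : exists x, (0 < rem x)%N.
    case: (pickP (fun x => (0 < rem x)%N)) => [x x0|no]; first by exists x.
    by move: sr; rewrite big1 // => x _; have := no x; case: (rem x).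
  by exists x; rewrite inE x0 andbT; apply: contraTT x0 => /remF'->.
rewrite cQ in cQr *.
rewrite (@state_value_new R n k r j q #|F| p _ _ _ erefl erefl); [|lia|lia].
apply: lerD; apply: ler_wpM2l => //.
  apply: (win_prob_fresh okc erefl cQ) => //; first by lia.
  move=> B x BA BQ; have [xFB remx cQ' x0] := fresh_state BA erefl cQ BQ remF'.
  have xc : x != c by apply: contraTneq x0 => ->; rewrite c0.
  split.
    rewrite -BQ; apply/setP => y; rewrite !inE.
    have [->|yc] /= := eqVneq y c; first by rewrite c0 !andbF.
    by case: (boolP (y \in F)) => //= /remF'->; rewrite ltnn !andbF.
  rewrite (negPf xc) -cQ' -(card_drawsD BA); apply: IHr => //.
    by rewrite (card_drawsD BA); lia.
  exact: sum_found.
apply: (win_prob_fresh okn erefl cQ) => //; first by lia.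
move=> B x BA BQ; have [xFB remx cQ' x0] := fresh_state BA erefl cQ BQ remF'.
split.
  rewrite -BQ; apply/setP => y; rewrite !inE.
  by case: (boolP (y \in F)) => //= /remF'->; rewrite ltnn !andbF.
rewrite -cQ' -(card_drawsD BA); apply: IHr => //.
  by rewrite (card_drawsD BA); lia.
exact: sum_found.
Qed.

Theorem theorem2 (R : realFieldType) (d k : nat) :
  (0 < d)%N -> (0 < k)%N ->
  exists N : nat, forall n : nat, (N <= n)%N ->
    is_value_M n d k ((k ^ d)%:R / ('C(n + d - 1, d))%:R : R).
Proof.
(* The threshold is the product of the original [k] and [d]: enough doors for disjoint draws in
   every round, and repeat probabilities at most 1. *)
case: d k => // d [//|k] _ _; exists (k.+1 * d.+1)%N => n; rewrite mulnS => dn.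
split; last first.
  case: n dn => // n dn.
  have -> : (n.+1 + d.+1 - 1 = d.+1 + n)%N by lia.
  exact: hider_bound.
pose cont B a := searcher R k d 1 a ([set: 'I_n] :\: B).
have ok B a : B \in draws [set: 'I_n] k.+1 -> mixed_ok k.+1 (cont B a).
  move=> BA; apply: mixed_ok_searcher; rewrite ?(card_drawsD BA) ?cardsT ?card_ord; lia.
have okg : mixed_ok k.+1 (guess (draws [set: 'I_n] k.+1) id cont).
  apply: mixed_ok_guess ok; first by rewrite cards_draws bin_gt0 cardsT card_ord; lia.
  by move=> B; rewrite inE => /andP[_ /eqP->].
exists (guess (draws [set: 'I_n] k.+1) id cont).
split; [by case: okg|split; [by case: okg|move=> [pl rv]]].
rewrite /payoffS /wins /=; pose rem (x : 'I_n) := count_mem x pl.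
have sr : (\sum_x rem x)%N = d.+1 by rewrite /rem sum_count_mem size_tuple.
pose Q := [set x in [set: 'I_n] | (0 < rem x)%N].
have cQr : (#|Q| <= d.+1)%N.
  rewrite -sr; apply: leq_trans (card_support rem).
  by apply: subset_leq_card; apply/subsetP => x; rewrite !inE.
have [q cQ] : exists q, #|Q| = q.+1.
  exists #|Q|.-1; rewrite prednK // card_gt0; apply/set0Pn.
  by exists (thead pl); rewrite !inE -has_count has_pred1 mem_tnth.
have remF y : y \notin [set: 'I_n] -> rem y = 0%N by rewrite inE.
have qn : (q.+1 <= n)%N by rewrite -cQ -[leqRHS]card_ord max_card.
have cT : #|[set: 'I_n]| = n by rewrite cardsT card_ord.
(* This is [state_value] after the first round, with [j = 1], without its last factor. Its
   ['C(n, 1 + q)] cancels the denominator of [win_prob_fresh], so the result is independent of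
   [q]. *)
pose u : R := (k.+1 ^ d * 'C(n, 1 + q))%:R / ('C(n + d, d + 1))%:R.
apply: le_trans (win_prob_fresh (u := u) (t := k.+1) ok erefl cQ _ okg _) => //.
- rewrite cT /u add1n addn1 addnS subn1 /= expnS !natrM.
  have z1 := @natr_bin_neq0 R n q.+1 qn; have z2 := @natr_bin_neq0 R (n + d)%N d.+1 ltac:(lia).
  by rewrite le_eqVlt; apply/orP; left; apply/eqP; field; rewrite z1 z2.
- by rewrite cT; lia.
move=> B x BA BQ; have [xFB remx cQ' x0] := fresh_state BA erefl cQ BQ remF.
split; first by rewrite -BQ; apply/setP => y; rewrite !inE.
rewrite /u -cQ' -(card_drawsD BA); apply: win_prob_searcher => //.
- by rewrite (card_drawsD BA) cT; lia.
- by lia.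
exact: sum_found.
Qed.
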